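(* Let $T$ be a tree, let $\lambda: T\to(0,\infty)$ be a weight, and let $\varphi:T\to T$ be an injective self-map such that $C_\varphi$ is a compact operator on $L^2_\lambda(T)$. If $C_\varphi\in S_1$, then $\varphi$ has a finite number of fixed points, i.e. $$|\{u\in T:\varphi(u)=u\}|<\infty.$$
   Context: A tree $T$ is a connected, locally finite graph without cycles on a countably infinite vertex set (identified with $T$), with a fixed vertex $o$ called the root, and with no terminal vertices (a terminal vertex is one having only one neighbour). For a weight $\lambda:T\to(0,\infty)$, $L^2_\lambda(T)$ is the separable Hilbert space of functions $f:T\to\mathbb{C}$ with $\sum_{v\in T}|f(v)|^2\lambda(v)<\infty$, with inner product $\langle f,g\rangle=\sum_{v\in T}f(v)\overline{g(v)}\lambda(v)$. The composition operator is $C_\varphi f(v)=f(\varphi(v))$. $S_1$ is the trace class of $L^2_\lambda(T)$: the compact operators $A$ whose singular values $\{\mu_n\}$ satisfy $\sum_n|\mu_n|<\infty$. $|A|$ denotes the number of elements of a set $A$. *)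

(* Defs.v *)
From HB Require Import structures.
From mathcomp Require Import all_boot all_order all_algebra.
From mathcomp Require Import finmap complex sesquilinear lra.
From mathcomp Require Import all_classical all_reals all_analysis.
From mathcomp.analysis.showcase Require summability.

Set Implicit Arguments.
Unset Strict Implicit.
Unset Printing Implicit Defensive.

Import Order.TTheory GRing.Theory Num.Theory.
Import numFieldNormedType.Exports.

Local Open Scope classical_set_scope.
Local Open Scope complex_scope.
Local Open Scope ring_scope.

Local Notation normc := ComplexField.Normc.normc.

Definition terminal (T : Type) (adj : rel T) (v : T) := exists! w, adj v w.

Record tree (T : countType) := Tree {
  adjacent : rel T;
  root : T;
  tree_infinite : infinite_set [set: T];
  tree_sym : symmetric adjacent;
  tree_irr : irreflexive adjacent;
  tree_connected : forall u v, exists2 p, path adjacent u p & last u p = v;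
  tree_locally_finite : forall v, finite_set [set w | adjacent v w];
  (* [ucycle] accepts the back-and-forth closed walk along one edge, so genuine
     cycles are those with at least three vertices. *)
  tree_acyclic : forall c, ucycle adjacent c -> (size c < 3)%N;
  tree_no_terminal : forall v, ~ terminal adjacent v }.

Section sums.
Context {R : realType} {T : choiceType}.
Local Notation psum := summability.partial_sum.
Local Notation tot := (@summability.totally T).
Implicit Types a b : T -> R.

(* [summability.sum] is the limit of the finite partial sums along the finite
   subsets of the index type ordered by inclusion; it is taken on real and
   imaginary parts because [R[i]] carries no topology in the library. *)
Definition complex_sum (x : T -> R[i]) : R[i] :=
  summability.sum (fun v => complex.Re (x v))
    +i* summability.sum (fun v => complex.Im (x v)).

#[local] Instance tot_pf : ProperFilter tot := summability.totally_filter.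

Lemma cvg_psum_ge0 a : (forall v, 0 <= a v) ->
  (\esum_(v in [set: T]) (a v)%:E < +oo)%E ->
  psum a @ tot --> fine (\esum_(v in [set: T]) (a v)%:E).
Proof.
move=> a0 afin.
set S := esum _ _ in afin *.
have S0 : (0 <= S)%E by apply: esum_ge0 => v _; rewrite lee_fin.
have Sfin : S \is a fin_num by rewrite ge0_fin_numE.
have psumE (A : {fset T}) : (psum a A)%:E = (\sum_(v \in [set` A]) (a v)%:E)%E.
  rewrite fsbig_finite//= set_fsetK sumEFin /summability.partial_sum.
  by rewrite big_seq_fsetE.
have psum_le A : psum a A <= fine S.
  rewrite -lee_fin fineK// psumE; apply: ereal_sup_ubound.
  by exists [set` A] => //; split.
apply/cvgrPdist_le => e e0.
have : ((fine S - e)%:E < S)%E by rewrite -[ltRHS]fineK// lte_fin ltrBlDr ltrDl.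
move=> /ereal_sup_gt[_ [X [finX _] <-]] SX.
exists (fset_set X) => // B XB /=.
rewrite ger0_norm ?subr_ge0// lerBlDr -lerBlDl ltW//.
rewrite -lte_fin (lt_le_trans SX)// psumE; apply: lee_fsum_nneg_subset => //.
- move=> v; rewrite !inE => Xv; apply: (fsubsetP XB).
  by rewrite in_fset_set// inE.
- by move=> v _; rewrite lee_fin.
Qed.

Lemma psumD a b : psum (a \+ b) = psum a \+ psum b.
Proof. by apply/funext => A; rewrite /summability.partial_sum big_split. Qed.

Lemma psumZ (k : R) a : psum (fun v => k * a v) = (fun A => k * psum a A).
Proof. by apply/funext => A; rewrite /summability.partial_sum mulr_sumr. Qed.

Definition abs_summable a := (\esum_(v in [set: T]) `|a v|%:E < +oo)%E.

Lemma abs_summable_le a b :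
  (forall v, `|b v| <= `|a v|) -> abs_summable a -> abs_summable b.
Proof.
by move=> ba; apply: le_lt_trans; apply: le_esum => v _; rewrite lee_fin.
Qed.

Lemma abs_summableD a b :
  abs_summable a -> abs_summable b -> abs_summable (a \+ b).
Proof.
move=> afin bfin.
apply: (@le_lt_trans _ _ (\esum_(v in [set: T]) (`|a v|%:E + `|b v|%:E))%E).
  by apply: le_esum => v _; rewrite -EFinD lee_fin ler_normD.
by rewrite esumD ?lte_add_pinfty.
Qed.

Lemma abs_summableZ (k : R) a :
  abs_summable a -> abs_summable (fun v => k * a v).
Proof.
move=> afin.
have S0 : (0 <= \esum_(v in [set: T]) `|a v|%:E)%E by exact: esum_ge0.
have Sfin : \esum_(v in [set: T]) `|a v|%:E \is a fin_num.
  by rewrite ge0_fin_numE.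
apply: (@le_lt_trans _ _ (`|k|%:E * \esum_(v in [set: T]) `|a v|%:E)%E); last first.
  by rewrite -(fineK Sfin) -EFinM ltry.
apply: ge_ereal_sup => _ [X [finX _] <-].
under eq_fsbigr do rewrite normrM EFinM.
rewrite -ge0_mule_fsumr; last by move=> v; rewrite lee_fin.
by rewrite lee_wpmul2l ?lee_fin//; apply: ereal_sup_ubound; exists X.
Qed.

Lemma is_cvg_psum a : abs_summable a -> cvg (psum a @ tot).
Proof.
move=> afin.
have h v : a v = (`|a v| + a v) + (-1) * `|a v| by lra.
have -> : psum a = psum ((fun v => `|a v| + a v) \+ (fun v => (-1) * `|a v|)).
  by congr psum; apply/funext => v; exact: h.
have abs0 v : 0 <= `|a v| + a v by rewrite -lerBlDr sub0r -normrN ler_norm.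
have afin' : abs_summable (fun v => `|a v|).
  by apply: abs_summable_le afin => v; rewrite normr_id.
have cabs : cvg (psum (fun v => `|a v|) @ tot).
  by apply/cvg_ex; eexists; exact: cvg_psum_ge0.
rewrite psumD psumZ; apply: is_cvgD; last by apply: is_cvgMr.
apply/cvg_ex; eexists; apply: cvg_psum_ge0 => //.
have := abs_summableD afin' afin; apply: le_lt_trans.
by apply: le_esum => v _; rewrite lee_fin ler_norm.
Qed.

Lemma sumD a b : abs_summable a -> abs_summable b ->
  summability.sum (fun v => a v + b v)
  = summability.sum a + summability.sum b.
Proof.
move=> /is_cvg_psum ca /is_cvg_psum cb.
rewrite /summability.sum (_ : psum (fun v => _) = psum a \+ psum b) ?limD//.
exact: psumD.
Qed.

Lemma sumZ (k : R) a : abs_summable a ->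
  summability.sum (fun v => k * a v) = k * summability.sum a.
Proof.
move=> /is_cvg_psum ca.
rewrite /summability.sum psumZ; apply: cvg_lim => //.
by apply: cvgM ca; exact: cvg_cst.
Qed.

Lemma sum_ge0E a : (forall v, 0 <= a v) -> abs_summable a ->
  summability.sum a = fine (\esum_(v in [set: T]) (a v)%:E).
Proof.
move=> a0 afin; apply: cvg_lim => //; apply: cvg_psum_ge0 => //.
by apply: le_lt_trans afin; apply: le_esum => v _; rewrite lee_fin ler_norm.
Qed.

End sums.

Section complex_sums.
Context {R : realType} {T : choiceType}.
Implicit Types (x y : T -> R[i]) (z : R[i]).

Definition csummable x := abs_summable (fun v => normc (x v)).

Lemma normc_ge0 z : 0 <= normc z. Proof. by case: z => r i; exact: sqrtr_ge0. Qed.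

Lemma Re_le_normc z : `|complex.Re z| <= normc z.
Proof. by case: z => r i /=; rewrite -sqrtr_sqr ler_wsqrtr// lerDl sqr_ge0. Qed.

Lemma Im_le_normc z : `|complex.Im z| <= normc z.
Proof. by case: z => r i /=; rewrite -sqrtr_sqr ler_wsqrtr// lerDr sqr_ge0. Qed.

Lemma csummable_Re x : csummable x -> abs_summable (fun v => complex.Re (x v)).
Proof.
by apply: abs_summable_le => v; rewrite (ger0_norm (normc_ge0 _)) Re_le_normc.
Qed.

Lemma csummable_Im x : csummable x -> abs_summable (fun v => complex.Im (x v)).
Proof.
by apply: abs_summable_le => v; rewrite (ger0_norm (normc_ge0 _)) Im_le_normc.
Qed.

Lemma complex_sumD x y : csummable x -> csummable y ->
  complex_sum (fun v => x v + y v) = complex_sum x + complex_sum y.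
Proof.
move=> xs ys; rewrite /complex_sum.
rewrite (_ : (fun v => complex.Re (x v + y v)) =
             fun v => complex.Re (x v) + complex.Re (y v)); last first.
  by apply/funext => v; case: (x v) (y v) => [? ?] [].
rewrite (_ : (fun v => complex.Im (x v + y v)) =
             fun v => complex.Im (x v) + complex.Im (y v)); last first.
  by apply/funext => v; case: (x v) (y v) => [? ?] [].
rewrite sumD; [|exact: csummable_Re..].
by rewrite sumD; [|exact: csummable_Im..].
Qed.

Lemma complex_sumZ k x : csummable x ->
  complex_sum (fun v => k * x v) = k * complex_sum x.
Proof.
move=> xs; rewrite /complex_sum; case: k => r i.
have xr := csummable_Re xs; have xi := csummable_Im xs.
rewrite (_ : (fun v => complex.Re ((r +i* i) * x v)) =
             fun v => r * complex.Re (x v) + (- i) * complex.Im (x v)); last first.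
  by apply/funext => v; case: (x v) => ? ? /=; rewrite mulNr.
rewrite (_ : (fun v => complex.Im ((r +i* i) * x v)) =
             fun v => r * complex.Im (x v) + i * complex.Re (x v)); last first.
  by apply/funext => v; case: (x v).
rewrite sumD; [|exact: abs_summableZ..].
rewrite sumD; [|exact: abs_summableZ..].
by rewrite !sumZ// mulNr.
Qed.

Lemma complex_sum_conj x : csummable x ->
  complex_sum (fun v => Num.conj (x v)) = Num.conj (complex_sum x).
Proof.
move=> xs; rewrite /complex_sum /=; congr (_ +i* _).
  by congr summability.sum; apply/funext => v; case: (x v).
rewrite -mulN1r -sumZ; last exact: csummable_Im.
by congr summability.sum; apply/funext => v; case: (x v) => ? ?; rewrite mulN1r.
Qed.

Lemma complex_sum_ge0E (a : T -> R) : (forall v, 0 <= a v) -> abs_summable a ->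
  complex_sum (fun v => (a v)%:C) = (fine (\esum_(v in [set: T]) (a v)%:E))%:C.
Proof.
move=> a0 afin; rewrite /complex_sum /= sum_ge0E//; congr (_ +i* _).
rewrite sum_ge0E ?esum1 //= /abs_summable.
by rewrite esum1 ?ltry// => v _; rewrite normr0.
Qed.

End complex_sums.

Section L2.
Context {R : realType} {T : choiceType}.
Variable lambda : T -> {posnum R}.
Implicit Types f g : T -> R[i].

Definition square_summable f :=
  (\esum_(v in [set: T]) (normc (f v) ^+ 2 * (lambda v)%:num)%:E < +oo)%E.

Definition L2_pred : {pred T -> R[i]} := [pred f | `[< square_summable f >]].

Lemma sqr_weight_ge0 f v : 0 <= normc (f v) ^+ 2 * (lambda v)%:num.
Proof. by rewrite mulr_ge0// sqr_ge0. Qed.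

Lemma square_summableE f : square_summable f =
  abs_summable (fun v => normc (f v) ^+ 2 * (lambda v)%:num).
Proof.
rewrite /square_summable /abs_summable; congr (_ < _)%E; apply: eq_esum => v _.
by rewrite (ger0_norm (sqr_weight_ge0 _ _)).
Qed.

Lemma L2_submod_closed : submod_closed L2_pred.
Proof.
split=> [|k f g].
  apply/asboolP; rewrite /square_summable esum1 ?ltry// => v _.
  by rewrite ComplexField.Normc.normc0 expr0n mul0r.
move=> /asboolP; rewrite square_summableE => fs.
move=> /asboolP; rewrite square_summableE => gs.
apply/asboolP; rewrite square_summableE.
have := abs_summableD (abs_summableZ (2 * normc k ^+ 2) fs) (abs_summableZ 2 gs).
apply: abs_summable_le => v /=.
have fv := sqr_weight_ge0 f v; have gv := sqr_weight_ge0 g v.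
rewrite (ger0_norm (sqr_weight_ge0 (k *: f + g) v)) ger0_norm; last first.
  by rewrite addr_ge0// mulr_ge0// mulr_ge0// sqr_ge0.
rewrite [leLHS](_ : _ = normc (k * f v + g v) ^+ 2 * (lambda v)%:num)//.
rewrite !mulrA -mulrDl ler_wpM2r//.
have := le_normcD (k * f v) (g v); rewrite ComplexField.Normc.normcM.
have := normc_ge0 (k * f v + g v); set c := normc (_ + _) => c0.
have := normc_ge0 k; have := normc_ge0 (f v); have := normc_ge0 (g v).
move: (normc k) (normc (f v)) (normc (g v)) => K F G G0 F0 K0 cKFG.
have : c ^+ 2 <= (K * F + G) ^+ 2 by rewrite lerXn2r// nnegrE addr_ge0// mulr_ge0.
have := sqr_ge0 (K * F - G); rewrite !expr2; nra.
Qed.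

HB.instance Definition _ :=
  GRing.isSubmodClosed.Build _ _ L2_pred L2_submod_closed.

Record L2 := MkL2 { L2_fun :> T -> R[i]; L2_funP : L2_fun \in L2_pred }.

HB.instance Definition _ := [isSub for L2_fun].
HB.instance Definition _ := [Choice of L2 by <:].
HB.instance Definition _ := [SubChoice_isSubLmodule of L2 by <:].

Definition L2_dot (f g : L2) : R[i] :=
  complex_sum (fun v => f v * Num.conj (g v) * ((lambda v)%:num)%:C).

End L2.

Section L2_dot.
Context {R : realType} {T : choiceType}.
Variable lambda : T -> {posnum R}.
Implicit Types f g h : L2 lambda.

Lemma L2P f : square_summable lambda f.
Proof. by have /asboolP := L2_funP f. Qed.

Lemma L2_dot_summable f g :
  csummable (fun v => f v * Num.conj (g v) * ((lambda v)%:num)%:C).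
Proof.
have := L2P f; rewrite square_summableE => fs.
have := L2P g; rewrite square_summableE => gs.
have := abs_summableD fs gs; apply: abs_summable_le => v.
rewrite ger0_norm ?normc_ge0// ger0_norm; last first.
  by rewrite addr_ge0// sqr_weight_ge0.
rewrite !ComplexField.Normc.normcM.
have -> : normc (((lambda v)%:num)%:C : R[i]) = (lambda v)%:num.
  by rewrite /= expr0n/= addr0 sqrtr_sqr ger0_norm.
have -> : normc (Num.conj (g v)) = normc (g v).
  by case: (g v) => r i /=; rewrite sqrrN.
rewrite /= -mulrDl ler_wpM2r//.
have := normc_ge0 (f v); have := normc_ge0 (g v).
move: (normc _) (normc _) => G F G0 F0.
have := sqr_ge0 (F - G); rewrite !expr2; nra.
Qed.

Lemma L2_dotE f : L2_dot f f =
  (fine (\esum_(v in [set: T]) (normc (f v) ^+ 2 * (lambda v)%:num)%:E))%:C.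
Proof.
rewrite -complex_sum_ge0E; first last.
- by have := L2P f; rewrite square_summableE.
- by move=> v; exact: sqr_weight_ge0.
congr complex_sum; apply/funext => v; rewrite rmorphM; congr (_ * _).
rewrite rmorphXn /= -normCK; congr (_ ^+ 2).
Qed.

Lemma L2_dot_hermitian f g : L2_dot f g = (-1) ^+ false * Num.conj (L2_dot g f).
Proof.
rewrite expr0 mul1r.
have -> : Num.conj (L2_dot g f) =
    complex_sum
      (fun v => Num.conj (g v * Num.conj (f v) * ((lambda v)%:num)%:C)).
  by rewrite complex_sum_conj //; exact: L2_dot_summable.
congr complex_sum; apply/funext => v.
have cl : Num.conj ((lambda v)%:num%:C : R[i]) = (lambda v)%:num%:C.
  exact: conjc_real.
by rewrite !rmorphM /= conjCK cl [X in X * _]mulrC.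
Qed.

Lemma L2_dot_linear g : scalar (@L2_dot R T lambda ^~ g).
Proof.
move=> k f h; rewrite /L2_dot.
rewrite -complex_sumZ; last exact: L2_dot_summable.
rewrite -complex_sumD; first last.
- exact: L2_dot_summable.
- rewrite (_ : (fun v => _) =
      fun v => (k *: f) v * Num.conj (g v) * ((lambda v)%:num)%:C).
    exact: L2_dot_summable.
  by apply/funext => v; rewrite !mulrA.
by congr complex_sum; apply/funext => v; rewrite !mulrDl !mulrA.
Qed.

Lemma L2_dot_bilinear :
  bilinear_for *%R (Num.conj \; *%R) (@L2_dot R T lambda).
Proof.
split=> [g k f h|f k g h] /=; first exact: L2_dot_linear.
rewrite L2_dot_hermitian L2_dot_linear rmorphD rmorphM /=.
by rewrite !expr0 !mul1r [L2_dot f g]L2_dot_hermitian [L2_dot f h]L2_dot_hermitian !expr0 !mul1r.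
Qed.

HB.instance Definition _ := bilinear_isBilinear.Build R[i] (L2 lambda)
  (L2 lambda) R[i] *%R (Num.conj \; *%R) (@L2_dot R T lambda) L2_dot_bilinear.

HB.instance Definition _ := isHermitianSesquilinear.Build R[i] (L2 lambda)
  false Num.conj (@L2_dot R T lambda) L2_dot_hermitian.

Lemma L2_dot_gt0 f : f != 0 -> 0 < L2_dot f f.
Proof.
move=> f0; have [v fv0] : exists v, f v != 0.
  apply: contrapT => /forallNP fv; move/negP: f0; apply; apply/eqP/val_inj.
  by apply/funext => v; apply/eqP/negPn/negP; exact: fv.
rewrite L2_dotE ltcR.
have Sfin : (\esum_(v in [set: T]) (normc (f v) ^+ 2 * (lambda v)%:num)%:E < +oo)%E.
  exact: L2P.
apply: fine_gt0; rewrite Sfin andbT.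
apply: (@lt_le_trans _ _ (normc (f v) ^+ 2 * (lambda v)%:num)%:E).
  rewrite lte_fin mulr_gt0// exprn_gt0// lt_def normc_ge0 andbT.
  by apply: contra fv0 => /eqP/ComplexField.Normc.eq0_normc ->.
by apply: esum_ge; exists [set v]; [split|rewrite fsbig_set1].
Qed.

HB.instance Definition _ := isDotProduct.Build R[i] (L2 lambda)
  (@L2_dot R T lambda) L2_dot_gt0.

End L2_dot.

Section dot_norm.
Context {C : numClosedFieldType} {U : lmodType C}.
Variable dot : {dot U for Num.conj}.
Local Notation "''[' u , v ]" := (dot u v) : ring_scope.
Local Notation "''[' u ]" := '[u, u] : ring_scope.

Definition dot_norm u := sqrtC '[u].

Lemma dot_normZ k u : dot_norm (k *: u) = `|k| * dot_norm u.
Proof.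
rewrite /dot_norm dnormZ sqrtCM ?nnegrE ?exprn_ge0 ?dnorm_ge0//.
by rewrite sqrCK.
Qed.

Lemma dot_norm_eq0 u : dot_norm u = 0 -> u = 0.
Proof. by move=> /eqP; rewrite sqrt_dnorm_eq0 => /eqP. Qed.

Lemma dot_cauchy_schwarz u v : `|'[u, v]| <= dot_norm u * dot_norm v.
Proof.
have [->|v0] := eqVneq v 0; first by rewrite linear0r normr0 mulr_ge0// sqrt_dnorm_ge0.
rewrite /dot_norm -sqrtCM ?nnegrE ?dnorm_ge0// -[leLHS]sqrCK// ler_sqrtC; last 2 first.
- by rewrite nnegrE exprn_ge0.
- by rewrite nnegrE mulr_ge0// dnorm_ge0.
pose a := '[u, v] / '[v]; pose w := u - a *: v.
have ow : '[w, v] = 0.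
  by rewrite linearBl/= linearZl_LR divfK ?dnorm_eq0 ?subrr.
have -> : '[u, v] = a * '[v] by rewrite divfK ?dnorm_eq0.
have -> : '[u] = '[w] + `|a| ^+ 2 * '[v].
  rewrite -dnormZ -hnormDd ?subrK//=.
  by rewrite linearZr_LR/= ow mulr0.
rewrite normrM exprMn (ger0_norm (dnorm_ge0 _ _)) mulrDl expr2 [X in _ * X]expr2.
by rewrite !mulrA lerDr mulr_ge0// dnorm_ge0.
Qed.

Lemma ler_dot_normD u v : dot_norm (u + v) <= dot_norm u + dot_norm v.
Proof.
have n0 w : 0 <= dot_norm w by exact: sqrt_dnorm_ge0.
rewrite -ler_sqr ?nnegrE ?addr_ge0// sqrrD !sqrtCK dnormD.
rewrite [leLHS]addrAC lerD2r lerD2l.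
have -> : '[u, v] + ('[u, v])^* = 'Re '[u, v] *+ 2.
  by rewrite -mulr_natr ReE divfK ?pnatr_eq0.
rewrite lerMn2r /=; apply: le_trans (dot_cauchy_schwarz u v).
exact: leif_Re_Creal.
Qed.

End dot_norm.

Section L2_normed.
Context {R : realType} {T : choiceType}.
Variable lambda : T -> {posnum R}.

HB.instance Definition _ := Lmodule_isNormed.Build R[i] (L2 lambda)
  (@ler_dot_normD _ _ (@L2_dot R T lambda)) (@dot_normZ _ _ (@L2_dot R T lambda))
  (@dot_norm_eq0 _ _ (@L2_dot R T lambda)).

Lemma L2_normE (f : L2 lambda) : `|f| = sqrtC (L2_dot f f).
Proof. by []. Qed.

End L2_normed.

Definition compact_operator (K : numFieldType) (V : normedModType K)
    (A : {linear V -> V}) :=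
  precompact (A @` [set f | `|f| <= 1]).

Definition eigenspace (K : fieldType) (V : lmodType K) (A : V -> V) (a : K) :
  set V := [set f | A f = a *: f].

Definition has_dimension (K : fieldType) (V : lmodType K) (E : set V) (k : nat) :=
  exists e : 'I_k -> V,
    let comb := fun c : 'rV[K]_k => \sum_i c 0 i *: e i in
    injective comb /\ range comb = E.

Section singular_values.
Context {R : realType} {V : normedModType R[i]}.
Variable dot : {dot V for Num.conj}.

Definition adjoint_of (A B : V -> V) := forall f g, dot (A f) g = dot f (B g).

(* The adjoint, when it exists, is unique since [dot] is definite.
   [mu] lists the square roots of the eigenvalues of [A* A] in nonincreasing
   order, each repeated according to its multiplicity and completed with zeros
   when only finitely many are nonzero. *)
Definition singular_values (A : V -> V) (mu : R^nat) :=
  exists2 B, adjoint_of A B &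
    [/\ nonincreasing_seq mu, forall n, 0 <= mu n &
        forall s, 0 < s -> exists2 k,
          has_dimension (eigenspace (B \o A) (s ^+ 2)%:C) k &
          ([set n | mu n = s] #= `I_k)%card].

Definition trace_class (A : {linear V -> V}) :=
  compact_operator A /\
  exists2 mu, singular_values A mu & cvgn (series (fun n => `|mu n|)).

End singular_values.

Definition composition_operator (R : realType) (T : choiceType)
    (lambda : T -> {posnum R}) (phi : T -> T) (A : L2 lambda -> L2 lambda) :=
  forall f v, A f v = f (phi v).

(* Main.v *)
Require Import Defs.
From mathcomp Require Import all_boot all_order all_algebra.
From mathcomp Require Import complex sesquilinear finmap.
From mathcomp Require Import all_classical all_reals all_analysis.

Import Order.TTheory GRing.Theory Num.Theory.
Import numFieldNormedType.Exports.

Local Open Scope classical_set_scope.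
Local Open Scope ring_scope.

(** The point mass at a fixed point [u] of [phi] satisfies [C delta_u = delta_u]
    by injectivity, and [C^* delta_u = delta_u] because [C f] and [f] agree at
    [u]. So the fixed points give linearly independent eigenvectors of [C^* C]
    for the eigenvalue 1, whose multiplicity as a singular value is finite. *)

(** The coordinates of the [d j] along [e] form the rows of an [m] by [k] matrix; freeness makes
    these rows independent, so [m] is at most the number of columns. *)
Lemma free_leq_dimension (K : fieldType) (V : lmodType K) (E : set V)
    (k m : nat) (d : 'I_m -> V) :
  has_dimension E k -> (forall j, E (d j)) ->
  (forall w : 'rV[K]_m, \sum_j w 0 j *: d j = 0 -> w = 0) ->
  (m <= k)%N.
Proof.
move=> [e [_ combE]] dE free.
have /choice[c cE] j : exists c : 'rV[K]_k, \sum_i c 0 i *: e i = d j.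
  by have := dE j; rewrite -combE => -[c _ cj]; exists c.
pose M := \matrix_j c j.
suff : row_free M by move=> /eqP <-; exact: rank_leq_col.
rewrite -kermx_eq0; apply/eqP/row_matrixP => j; rewrite row0; apply: free.
(* A row [w] of the left kernel of [M] gives a vanishing combination of the [d j]: swapping the
   sums, the coefficient of [e i] is entry [i] of [w *m M]. *)
set w := row j _.
have wM : w *m M = 0 by apply/sub_kermxP; exact: row_sub.
under eq_bigr do rewrite -cE scaler_sumr.
rewrite exchange_big big1//= => i _.
under eq_bigr do rewrite scalerA.
have := congr1 (fun N : 'rV_k => N 0 i) wM; rewrite !mxE => wMi.
rewrite -scaler_suml (_ : \sum_l _ = 0) ?scale0r//; apply: etrans wMi.
by apply: eq_bigr => l _; rewrite [M l i]mxE.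
Qed.

Section point_mass.
Context {R : realType} {T : choiceType} (lambda : T -> {posnum R}).

Lemma point_mass_L2 u : (fun v : T => (v == u)%:R : R[i]) \in L2_pred lambda.
Proof.
apply/asboolP; rewrite /square_summable.
rewrite (_ : esum _ _ = \esum_(v in [set u]) ((lambda v)%:num)%:E).
  by rewrite esum_set1 ?ltry// lee_fin.
rewrite [RHS]esum_mkcond; apply: eq_esum => v _; rewrite in_set1.
case: eqVneq => _.
  by rewrite ComplexField.Normc.normc1 expr1n mul1r.
by rewrite ComplexField.Normc.normc0 expr0n mul0r.
Qed.

Definition point_mass u : L2 lambda := MkL2 (point_mass_L2 u).

Lemma point_mass_free m (u : 'I_m -> T) (w : 'rV[R[i]]_m) : injective u ->
  \sum_j w 0 j *: point_mass (u j) = 0 -> w = 0.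
Proof.
move=> u_inj w0; apply/rowP => l; rewrite mxE.
have L2_fun_sum (s : seq 'I_m) (f : 'I_m -> L2 lambda) v :
    (\sum_(j <- s) f j : L2 lambda) v = \sum_(j <- s) f j v.
  by elim/big_rec2 : _ => // j x y _ <-.
(* Evaluating the combination at [u l] isolates the coefficient [w 0 l]. *)
have := L2_fun_sum (index_enum _) (fun j => w 0 j *: point_mass (u j)) (u l).
rewrite w0 (bigD1 l)//= big1 => [|j jl].
  rewrite [RHS]addr0 => /esym; rewrite [LHS](_ : _ = w 0 l * (u l == u l)%:R)//.
  by rewrite eqxx mulr1.
rewrite [LHS](_ : _ = w 0 j * (u l == u j)%:R)//.
by rewrite (inj_eq u_inj) eq_sym (negbTE jl) mulr0.
Qed.

Variables (phi : T -> T) (A : L2 lambda -> L2 lambda).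
Hypotheses (phi_inj : injective phi) (A_comp : composition_operator phi A).

Lemma composition_point_mass u : phi u = u -> A (point_mass u) = point_mass u.
Proof.
move=> uE; apply/val_inj/funext => v; rewrite /= A_comp /=.
(* Writing [u] as [phi u] turns the test [phi v == u] into [v == u]. *)
by rewrite -[in LHS]uE (inj_eq phi_inj).
Qed.

Lemma adjoint_point_mass B u : adjoint_of (@L2_dot R T lambda) A B ->
  phi u = u -> B (point_mass u) = point_mass u.
Proof.
move=> AB uE; apply/eqP; rewrite -subr_eq0.
set g := B _ - _.
have dotE f : L2_dot f (B (point_mass u)) = L2_dot f (point_mass u).
  (* Only the term at [v = u] survives, where [f (phi u) = f u]. *)
  rewrite -AB; congr complex_sum; apply/funext => v; rewrite A_comp /=.
  by case: eqVneq => [->|_]; rewrite ?uE// !rmorph0 !mulr0.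
(* By [dotE], [g] is orthogonal to every vector, hence to itself. *)
by rewrite -(dnorm_eq0 (@L2_dot R T lambda)) {2}/g linearBr/= dotE subrr.
Qed.

End point_mass.

Theorem corollary4p8 (R : realType) (T : countType) (G : tree T)
  (lambda : T -> {posnum R}) (phi : T -> T) (phi_inj : injective phi)
  (Cphi : {linear L2 lambda -> L2 lambda})
  (Cphi_comp : composition_operator phi Cphi)
  (Cphi_compact : compact_operator Cphi) :
  trace_class (@L2_dot R T lambda) Cphi ->
  finite_set [set u : T | phi u = u].
Proof.
move=> [_ [mu [B BA [_ _ /(_ 1 ltr01)[k dimk _]]] _]].
(* Here [k] is the multiplicity of the singular value 1; infinitely many fixed points would supply a
   set [F] of at least [k.+1] of them. *)
apply: contrapT => /infinite_set_fset => /(_ k.+1)[F Ffix].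
apply/negP; rewrite -leqNgt.
pose u := tnth (in_tuple F).
have uE j : phi (u j) = u j by apply: Ffix; exact: mem_tnth.
apply: (@free_leq_dimension _ _ _ _ _ (point_mass lambda \o u) dimk) => [j|w].
  rewrite /Defs.eigenspace /= (composition_point_mass _ _ _ phi_inj)//.
  by rewrite (adjoint_point_mass _ _ _ Cphi_comp)// expr1n scale1r.
by apply: point_mass_free; apply/tuple_uniqP; exact: fset_uniq.
Qed.
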